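(* Under the standing assumptions below, for every $\gamma\in\mathbb R^I$, $x_0\in\mathcal X$, $s_0\in\mathcal S$, the ex-ante lottery problem for $(\gamma,x_0,s_0)$ admits a maximizer $P^*\in\mathcal P(\tilde{\mathcal A}^\infty(x_0))$.
   Context: Setup. Let $\mathcal S$ be a finite set and $(s_t)_{t\ge0}$ a Markov chain on $\mathcal S$ with transition probabilities $\pi(s'|s)>0$ for all $s,s'\in\mathcal S$; for $s^t=(s_0,\dots,s_t)\in\mathcal S^{t+1}$, $\mathbb E_{s^t}$ denotes expectation over future shocks given $s^t$. Let $\mathcal A\subset\mathbb R^n$ be a finite set, $\mathcal X\subseteq\mathbb R^m$ a countable set, $\zeta:\mathcal X\times\mathcal A\times\mathcal S\to\mathcal X$, $p:\mathcal X\times\mathcal A\times\mathcal S\to\mathbb R$, $r,g^1,\dots,g^I$ bounded real functions on $\mathcal X\times\mathcal A\times\mathcal S$, $\bar g^i\in\mathbb R$, $\beta\in(0,1)$. A plan is $a=(a(s^t))_{t,s^t}$, $a(s^t)\in\mathcal A$, inducing $x(s^0)=x_0$, $x(s^{t+1})=\zeta(x(s^t),a(s^t),s_t)$. $\tilde{\mathcal A}(x,s)=\{a\in\mathcal A:p(x,a,s)\ge0\}$; $\tilde{\mathcal A}^\infty(x_0)$ is the set of plans with $a(s^t)\in\tilde{\mathcal A}(x(s^t),s_t)$ for all $t,s^t$. A plan is feasible for $(x_0,s_0)$ if it lies in $\tilde{\mathcal A}^\infty(x_0)$ and $\mathbb E_{s^t}\sum_{n\ge0}\beta^ng^i(x(s^{t+n}),a(s^{t+n}),s_{t+n})\ge\bar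 g^i$ for all $t,s^t,i$. Standing assumption: for every $(x_0,s_0)$ a feasible plan exists. Pre-action histories: $\mathcal H^t=\mathcal S^{t+1}\times\mathcal A^t$. Ex-ante lottery problem. Give $\tilde{\mathcal A}^\infty(x_0)$ the product topology and let $\mathcal P(\tilde{\mathcal A}^\infty(x_0))$ be the set of Borel probability measures on it; a random plan $a\sim P$ is drawn independently of the shocks. For $\gamma\in\mathbb R^I$, the ex-ante lottery problem is to maximize $\mathbb E^{a\sim P}_{s_0}\sum_{t\ge0}\beta^t\big(r(x(s^t),a(s^t),s_t)+\sum_i\gamma^ig^i(x(s^t),a(s^t),s_t)\big)$ over $P\in\mathcal P(\tilde{\mathcal A}^\infty(x_0))$ subject to: for all $t\ge0$, all $h^t=(s_0,\tilde a_0,\dots,s_{t-1},\tilde a_{t-1},s_t)\in\mathcal H^t$ and all $i$, $\mathbb E^{a\sim P}_{s^t}\Big[\mathbf 1\{(a(s^0),\dots,a(s^{t-1}))=(\tilde a_0,\dots,\tilde a_{t-1})\}\Big(\sum_{n\ge0}\beta^ng^i(x(s^{t+n}),a(s^{t+n}),s_{t+n})-\bar g^i\Big)\Big]\ge0$, where $s^t$ is the shock history contained in $h^t$ and the expectation is over $a\sim P$ and future shocks given $s^t$. *)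

(* Defs.v *)
From HB Require Import structures.
From mathcomp Require Import all_boot all_order all_algebra.
From mathcomp Require Import all_classical all_reals all_analysis.
Set Implicit Arguments. Unset Strict Implicit. Unset Printing Implicit Defensive.
Import Order.TTheory GRing.Theory Num.Theory.
Local Open Scope classical_set_scope.
Local Open Scope ring_scope.

(* A shock history s^t = (s_0, s_1, ..., s_t) is represented as the pair
   (s_0, [:: s_1; ...; s_t]); t is the length of the list. *)
Definition hist (S : Type) := (S * seq S)%type.

Definition hcur {S : Type} (h : hist S) : S := last h.1 h.2.

Definition hext {S : Type} (h : hist S) (l : seq S) : hist S := (h.1, h.2 ++ l).

Definition plan (S A : Type) := hist S -> A.

Section Model.
Context {R : realType} {S A X : Type}.

Fixpoint ppath (pi : S -> S -> R) (s : S) (l : seq S) : R :=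
  match l with
  | [::] => 1
  | s' :: l' => pi s s' * ppath pi s' l'
  end.

(* state induced by the plan: x(s^0) = x0, x(s^{t+1}) = zeta(x(s^t), a(s^t), s_t) *)
Fixpoint xrun (zeta : X -> A -> S -> X) (a : plan S A) (s0 : S) (x : X)
  (pre rest : seq S) : X :=
  match rest with
  | [::] => x
  | s' :: rest' =>
      xrun zeta a s0 (zeta x (a (s0, pre)) (last s0 pre)) (rcons pre s') rest'
  end.

Definition xof (zeta : X -> A -> S -> X) (x0 : X) (a : plan S A) (h : hist S) : X :=
  xrun zeta a h.1 x0 [::] h.2.

Definition admissible (p : X -> A -> S -> R) (zeta : X -> A -> S -> X) (x0 : X)
  (a : plan S A) : Prop :=
  forall h : hist S, 0 <= p (xof zeta x0 a h) (a h) (hcur h).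

Definition stage (f : X -> A -> S -> R) (zeta : X -> A -> S -> X) (x0 : X)
  (a : plan S A) (h : hist S) : R :=
  f (xof zeta x0 a h) (a h) (hcur h).

Definition bounded_payoff (f : X -> A -> S -> R) : Prop :=
  exists M : R, forall x b s, `|f x b s| <= M.

End Model.

Section Expectations.
Context {R : realType} {S A : finType} {X : Type}.

Definition cond_exp (pi : S -> S -> R) (h : hist S) (n : nat)
  (F : hist S -> R) : R :=
  \sum_(l : n.-tuple S) ppath pi (hcur h) l * F (hext h l).

Definition disc_val (pi : S -> S -> R) (beta : R) (zeta : X -> A -> S -> X)
  (f : X -> A -> S -> R) (x0 : X) (a : plan S A) (h : hist S) : R :=
  limn (fun N => \sum_(0 <= n < N) beta ^+ n * cond_exp pi h n (stage f zeta x0 a)).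

Definition feasible_plan {I : nat} (pi : S -> S -> R) (beta : R)
  (zeta : X -> A -> S -> X) (p : X -> A -> S -> R)
  (g : 'I_I -> X -> A -> S -> R) (gbar : 'I_I -> R) (x0 : X) (a : plan S A) : Prop :=
  admissible p zeta x0 a /\
  forall (h : hist S) (i : 'I_I), gbar i <= disc_val pi beta zeta (g i) x0 a h.

Definition past_actions_match (a : plan S A) (s0 : S) (t : nat)
  (st : t.-tuple S) (ta : t.-tuple A) : bool :=
  [forall k : 'I_t, a (s0, take k st) == tnth ta k].

End Expectations.

(* The space of plans with the product topology (A discrete) and its Borel
   sigma-algebra.  The element a0 only serves to make the types pointed, as
   required by MathComp-Analysis measurable types. *)
Definition Apt (A : finType) (a0 : A) : Type := A.
HB.instance Definition _ (A : finType) (a0 : A) := Choice.copy (Apt a0) A.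
HB.instance Definition _ (A : finType) (a0 : A) := isPointed.Build (Apt a0) a0.

Definition plan_top (S A : finType) (a0 : A) :=
  {ptws hist S -> discrete_topology (Apt a0)}.

Definition plan_borel (S A : finType) (a0 : A) :=
  g_sigma_algebraType (@open (plan_top S a0)).

Section Lottery.
Context {R : realType} {S A : finType} {X : Type} (a0 : A).
Local Open Scope ereal_scope.

(* P is (the extension to all plans of) a Borel probability measure on
   \tilde A^\infty(x0) satisfying all the ex-ante lottery constraints *)
Definition lottery_feasible {I : nat} (pi : S -> S -> R) (beta : R)
  (zeta : X -> A -> S -> X) (p : X -> A -> S -> R)
  (g : 'I_I -> X -> A -> S -> R) (gbar : 'I_I -> R) (x0 : X)
  (P : probability (plan_borel S a0) R) : Prop :=
  P [set a : plan_borel S a0 | admissible p zeta x0 a] = 1 /\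
  forall (t : nat) (s0 : S) (st : t.-tuple S) (ta : t.-tuple A) (i : 'I_I),
    0 <= \int[P]_(a in [set: plan_borel S a0])
            ((past_actions_match a s0 st ta)%:R *
             (disc_val pi beta zeta (g i) x0 a (s0, val st) - gbar i))%:E.

Definition lottery_obj {I : nat} (pi : S -> S -> R) (beta : R)
  (zeta : X -> A -> S -> X) (r : X -> A -> S -> R)
  (g : 'I_I -> X -> A -> S -> R) (gam : 'I_I -> R) (x0 : X) (s0 : S)
  (P : probability (plan_borel S a0) R) : \bar R :=
  \int[P]_(a in [set: plan_borel S a0])
     (disc_val pi beta zeta
        (fun x b s => (r x b s + \sum_(i < I) gam i * g i x b s)%R)
        x0 a (s0, [::]))%:E.

End Lottery.

(* Main.v *)
Require Import Defs.
From HB Require Import structures.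
From mathcomp Require Import all_boot all_order all_algebra.
From mathcomp Require Import all_classical all_reals all_analysis measurable_realfun.
Import Order.TTheory GRing.Theory Num.Theory.
Import numFieldNormedType.Exports.
Local Open Scope classical_set_scope.
Local Open Scope ring_scope.

(** The space of plans is compact and has a countable basis of clopen cylinders.
    Along an ultrafilter U of probability measures, the masses of the clopen
    sets converge to a finitely additive set function, which is a premeasure
    because a clopen set covered by countably many clopen sets is covered by
    finitely many of them; so it extends to a Borel probability measure P.
    The integral of a uniform limit of locally constant functions converges
    along U to its integral against P.  All discounted values are such limits:
    truncating at horizon N leaves an error of order beta^N, uniformly in the
    plan.  Admissibility is a countable intersection of clopen events, so
    "P(admissible) = 1" also passes to the limit.  If U refines the filter
    generated by the sets { P feasible | obj Q <= obj P } (Q feasible), the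
    limit P is feasible and beats every feasible Q. *)

(* An alias of T, so that its clopen algebra and its Borel sigma-algebra are
   separate measurable structures. *)
Definition clopen_algebra (T : ptopologicalType) : Type := T.

Fact clopen_display : measure_display. Proof. by []. Qed.

Section ClopenAlgebra.
Context {T : ptopologicalType}.

Lemma clopen_setC : setC_closed (@clopen T).
Proof. by move=> A; apply: (clopenC set0). Qed.

HB.instance Definition _ := Pointed.on (clopen_algebra T).
HB.instance Definition _ := isAlgebraOfSets.Build clopen_display
  (clopen_algebra T) clopen0 clopenU clopen_setC.

End ClopenAlgebra.

(** * From finitely additive masses on clopen sets to Borel probability measures *)

Section ClopenExtension.
Context {R : realType} {T : ptopologicalType}.
Local Notation prob := (probability (g_sigma_algebraType (@open T)) R).
Hypothesis compactT : compact [set: T].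
Hypothesis open_bigcup_clopen : forall O : set T, open O ->
  exists2 F : nat -> set T, (forall n, clopen (F n)) & O = \bigcup_n F n.

(** Compactness stands in for countable additivity: a clopen set is compact, so a countable clopen
    cover reduces to a finite one, where finite additivity suffices. Carathéodory extension does the
    rest. *)
Lemma clopen_content_extension (m : set T -> R) :
  m setT = 1 ->
  (forall A, clopen A -> 0 <= m A) ->
  (forall A B, clopen A -> clopen B -> A `&` B = set0 ->
    m (A `|` B) = m A + m B) ->
  exists P : prob, forall A, clopen A -> P A = (m A)%:E.
Proof.
move=> m1 m_ge0 mU.
(* A content must be nonnegative on every set, while [m] is controlled on clopen sets only; hence
   the truncation at 0. *)
pose mu (A : set (clopen_algebra T)) : \bar R := (Num.max 0 (m A))%:E.
have muE A : clopen A -> mu A = (m A)%:E.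
  by move=> cA; rewrite /mu max_r// m_ge0.
have m0 : m set0 = 0.
  apply: (addrI (m set0)); rewrite addr0 -mU ?setU0 ?setI0//; exact: clopen0.
have mu_ge0 A : (0 <= mu A)%E by rewrite lee_fin le_max lexx.
have mu_add : measure_function.semi_additive mu.
  apply/additive2P; first by rewrite muE ?m0//; exact: clopen0.
  move=> A B cA cB AB; rewrite !muE ?mU//; exact: clopenU.
pose cmu : {content set (clopen_algebra T) -> \bar R} :=
  HB.pack mu (isContent.Build _ _ _ mu mu_ge0 mu_add).
have mu_sub : measurable_subset_sigma_subadditive cmu.
  move=> A F cF cA AF.
  have kA : compact (A : set T).
    by apply: (subclosed_compact _ compactT) => //; case: cA.
  move: kA; rewrite compact_cover => /(_ nat setT F) [].
  - by move=> i _; have [] := cF i.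
  - by [].
  (* [D] is the finite set of indices of a subcover; all of them lie below [N]. *)
  move=> D _ AD; pose N := (\max_(i <- finmap.enum_fset D) i).+1%N.
  have AN : A `<=` \big[setU/set0]_(i < N) F i.
    move=> x /AD [i iD Fix]; rewrite -bigcup_mkord; exists i => //=.
    rewrite ltnS; exact: (leq_bigmax_seq (F := id) i iD).
  apply: (le_trans (@content_subadditive _ _ _ cmu A F N _ cA AN)) => //.
  rewrite -(big_mkord xpredT (fun i => cmu (F i))).
  exact: nneseries_lim_ge.
have mu0 : mu set0 = 0%E by rewrite muE ?m0//; exact: clopen0.
have mu_sigma : semi_sigma_additive mu := semiring_sigma_additive mu_sub.
pose nu : {measure set (clopen_algebra T) -> \bar R} :=
  HB.pack mu (isMeasure.Build _ _ _ mu mu0 mu_ge0 mu_sigma).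
pose P (A : set (g_sigma_algebraType (@open T))) := measure_extension nu A.
have PE A : clopen A -> P A = (m A)%:E.
  move=> cA; rewrite -muE// /P /measure_extension /=.
  exact: (measurable_mu_extE nu).
(* The extension lives on the sigma-algebra generated by the clopen sets. It contains every open
   set, a countable union of clopen ones, so the extension restricts to the Borel sets. *)
have open_mble (A : set T) : <<s @open T >> A -> <<s @clopen T >> A.
  apply: smallest_sub; first exact: smallest_sigma_algebra.
  move=> O /open_bigcup_clopen[F cF ->].
  apply: (@bigcupT_measurable _ (g_sigma_algebraType (@clopen T))) => i.
  exact: sub_sigma_algebra.
have P_sigma : semi_sigma_additive P.
  move=> F mF tF mUF; apply: (measure_semi_sigma_additive (s := measure_extension nu)).
  - by move=> i; apply: open_mble; exact: mF.
  - by [].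
  - by apply: open_mble; exact: mUF.
have P0 : P set0 = 0%E by rewrite PE ?m0//; exact: clopen0.
have P1 : P setT = 1%E by rewrite PE ?m1//; exact: clopenT.
pose Pm : {measure set (g_sigma_algebraType (@open T)) -> \bar R} :=
  HB.pack P (isMeasure.Build _ _ _ P P0 (fun A => measure_ge0 (measure_extension nu) A) P_sigma).
(* The subject is [Measure.sort Pm] rather than [P] because only the former
   carries a canonical measure structure. *)
pose Pp : prob :=
  HB.pack (Measure.sort Pm) (Measure_isProbability.Build _ _ _ (Measure.sort Pm) P1).
by exists Pp.
Qed.

Lemma clopen_measurable (A : set T) : clopen A ->
  measurable (A : set (g_sigma_algebraType (@open T))).
Proof. by move=> [oA _]; exact: sub_sigma_algebra. Qed.

(** A cluster point of an ultrafilter is a limit: otherwise the complement of some neighbourhood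
    would be in the image filter, and the neighbourhood would have to meet it. *)
Lemma ultra_cvg_compact {I : Type} {V : topologicalType} (U : set_system I)
    (u : I -> V) (K : set V) :
  UltraFilter U -> compact K -> (\forall i \near U, K (u i)) ->
  exists2 l, K l & u i @[i --> U] --> l.
Proof.
move=> UU cK UK; have [l [Kl cl]] := cK (u @ U) _ UK.
exists l => // V' nV'; have [//|UnV] := in_ultra_setVsetC (u @^-1` V') UU.
by have [x [/= + ?]] := cl _ _ (UnV : (u @ U) (~` V')) nV'.
Qed.

(** Each mass stays in the compact interval from 0 to 1, so it converges along [U]; total mass,
    positivity and finite additivity survive the limit. *)
Lemma ultra_clopen_limit (U : set_system prob) :
  UltraFilter U ->
  exists P : prob,
    forall A, clopen A -> (fun Q : prob => fine (Q A)) @ U --> fine (P A).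
Proof.
move=> UU.
have cv A : clopen A -> cvg ((fun Q : prob => fine (Q A)) @ U).
  move=> cA.
  have [||l _ ul] := @ultra_cvg_compact _ R^o U (fun Q : prob => fine (Q A)) `[0, 1] UU.
  - exact: segment_compact.
  - apply: nearW => Q /=; rewrite in_itv/= fine_ge0//= -lee_fin fineK.
      by apply: probability_le1; exact: clopen_measurable.
    by rewrite fin_num_measure//; exact: clopen_measurable.
  exact: cvgP ul.
pose m A := lim ((fun Q : prob => fine (Q A)) @ U).
have [||A B cA cB AB|P PE] := @clopen_content_extension m.
- apply: cvg_lim => //; apply: cvg_near_cst; apply: nearW => Q.
  exact: (congr1 fine (probability_setT Q)).
- by move=> A cA; apply: limr_ge; [exact: cv|apply: nearW => Q; exact: fine_ge0].
- rewrite /m -limD; [|exact: cv..].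
  congr (lim (_ @ U)); apply/funext => Q /=.
  rewrite measureU ?fineD ?fin_num_measure//; exact: clopen_measurable.
by exists P => A cA; rewrite PE//=; exact: cv.
Qed.

End ClopenExtension.

(** * Locally constant functions *)

Section LocallyConstant.
Context {T : topologicalType}.

(** This is continuity into the discrete space [V], stated without putting a topology on [V]. *)
Definition locally_constant {V : Type} (f : T -> V) :=
  forall x, \forall y \near x, f y = f x.

Lemma locally_constant_cst {V : Type} (c : V) : locally_constant (fun=> c).
Proof. by move=> x; exact: nearW. Qed.

Lemma locally_constant_comp {V W : Type} (h : V -> W) (f : T -> V) :
  locally_constant f -> locally_constant (fun x => h (f x)).
Proof. by move=> lf x; apply: filterS (lf x) => y ->. Qed.

Lemma locally_constant_comp2 {V V' W : Type} (h : V -> V' -> W)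
    (f : T -> V) (f' : T -> V') :
  locally_constant f -> locally_constant f' ->
  locally_constant (fun x => h (f x) (f' x)).
Proof. by move=> lf lf' x; apply: filterS2 (lf x) (lf' x) => y -> ->. Qed.

Lemma locally_constant_finfun {J : finType} {V : Type} (f : J -> T -> V) :
  (forall j, locally_constant (f j)) ->
  locally_constant (fun x => [ffun j => f j x]).
Proof.
move=> lf x; have : \forall y \near x, forall j, f j y = f j x.
  by apply: filter_forall => j; exact: lf.
by apply: filterS => y fyx; apply/ffunP => j; rewrite !ffunE.
Qed.

Lemma locally_constant_sum {V : nmodType} {J : Type} (s : seq J)
    (f : J -> T -> V) : (forall j, locally_constant (f j)) ->
  locally_constant (fun x => \sum_(j <- s) f j x).
Proof.
move=> lf; elim: s => [|j s IH].
  by under eq_fun do rewrite big_nil; exact: locally_constant_cst.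
by under eq_fun do rewrite big_cons; exact: locally_constant_comp2.
Qed.

Lemma locally_constant_clopen {V : Type} (f : T -> V) (B : set V) :
  locally_constant f -> clopen (f @^-1` B).
Proof.
move=> lf; have op (D : set V) : open (f @^-1` D).
  rewrite openE => x /= Dfx; rewrite /interior /=.
  by apply: filterS (lf x) => y /= ->.
by split; [exact: op | rewrite -openC; exact: (op (~` B))].
Qed.

End LocallyConstant.

(** The fibres form an open cover; a finite subcover lists the values. *)
Lemma locally_constant_finite_range {T : ptopologicalType} {V : choiceType}
    (f : T -> V) :
  compact [set: T] -> locally_constant f ->
  exists2 s : seq V, uniq s & forall x, f x \in s.
Proof.
move=> cT lf; move: cT; rewrite compact_cover.
move=> /(_ V setT (fun v => f @^-1` [set v])) [].
- by move=> v _; have [] := locally_constant_clopen f [set v] lf.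
- by move=> x _; exists (f x).
move=> D _ TD; exists (undup (finmap.enum_fset D)); first exact: undup_uniq.
by move=> x; rewrite mem_undup; have [v vD /= ->] := TD x I.
Qed.

(** * Convergence of integrals along an ultrafilter, and existence of a maximizing measure *)

Section ClopenWeakLimit.
Context {R : realType} {T : ptopologicalType}.
Local Notation borel := (g_sigma_algebraType (@open T)).
Local Notation prob := (probability borel R).
Hypothesis compactT : compact [set: T].

(** The uniform closure of the locally constant functions, to which constraints and objective will
    belong. *)
Definition locally_constant_approx (F : T -> R) := forall e, 0 < e ->
  exists2 G : T -> R, locally_constant G & forall x, `|F x - G x| <= e.

Lemma locally_constant_measurable (F : T -> R) :
  locally_constant F -> measurable_fun [set: borel] F.
Proof.
move=> lF _ B _; rewrite setTI; apply: clopen_measurable.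
exact: locally_constant_clopen.
Qed.

Lemma locally_constant_bounded (F : T -> R) :
  locally_constant F -> exists M, forall x, `|F x| <= M.
Proof.
move=> lF; have [s _ Fs] := locally_constant_finite_range F compactT lF.
exists (\sum_(v <- s) `|v|) => x.
by rewrite (big_rem _ (Fs x))/= lerDl sumr_ge0.
Qed.

Lemma locally_constant_approx_measurable (F : T -> R) :
  locally_constant_approx F -> measurable_fun [set: borel] F.
Proof.
move=> aF; have /choice[G GP] (n : nat) : exists G : T -> R,
    locally_constant G /\ forall x, `|F x - G x| <= n.+1%:R^-1.
  have [|G lG FG] := aF (n.+1%:R^-1); first by rewrite invr_gt0 ltr0n.
  by exists G.
apply: (@measurable_fun_cvg _ borel R setT G F).
  by move=> n; apply: locally_constant_measurable; have [] := GP n.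
move=> x _; apply/cvgrPdist_le => e e0.
near=> n; apply: le_trans ((GP n).2 x) _.
by near: n; apply: filterS (near_infty_natSinv_lt (PosNum e0)) => n; exact: ltW.
Unshelve. all: by end_near. Qed.

Lemma locally_constant_approx_bounded (F : T -> R) :
  locally_constant_approx F -> exists M, forall x, `|F x| <= M.
Proof.
move=> aF; have [//|G /locally_constant_bounded[M GM] FG] := aF 1.
exists (1 + M) => x; rewrite -(subrK (G x) (F x)).
by apply: le_trans (ler_normD _ _) _; apply: lerD.
Qed.

Lemma integrable_prob (Q : prob) (F : borel -> R) :
  measurable_fun setT F -> (exists M, forall x, `|F x| <= M) ->
  Q.-integrable setT (EFin \o F).
Proof.
move=> mF [M FM]; apply: measurable_bounded_integrable => //.
  by apply: (@le_lt_trans _ _ 1%E); [exact: probability_le1|exact: ltry].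
exists M; split; first exact: num_real.
by move=> N /ltW MN x _; exact: le_trans (FM x) MN.
Qed.

Lemma locally_constant_approx_integrable (Q : prob) (F : T -> R) :
  locally_constant_approx F -> Q.-integrable setT (EFin \o F).
Proof.
by move=> aF; apply: integrable_prob; [exact: locally_constant_approx_measurable
  | exact: locally_constant_approx_bounded].
Qed.

Lemma integral_approxE (Q : prob) (F : T -> R) : locally_constant_approx F ->
  (\int[Q]_(x in [set: borel]) (F x)%:E = (\int[Q]_(x in [set: borel]) F x)%:E)%E.
Proof.
move=> aF; rewrite /Rintegral fineK//; apply: integrable_fin_num => //.
exact: locally_constant_approx_integrable.
Qed.

Section UltraLimit.
Context (U : set_system prob) {UU : UltraFilter U} (P : prob).
Hypothesis clopen_cvg : forall A, clopen A ->
  (fun Q : prob => fine (Q A)) @ U --> fine (P A).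

(** Measurability and a bound are carried along because they make [F] integrable under every
    probability, as linearity of the integral demands. *)
Definition integral_cvg (F : borel -> R) :=
  [/\ measurable_fun setT F, exists M, forall x, `|F x| <= M
    & (fun Q : prob => \int[Q]_x F x) @ U --> \int[P]_x F x].

Lemma integral_cvg_indic A : clopen A -> integral_cvg (\1_A).
Proof.
move=> cA; have mA := clopen_measurable _ cA; split.
- exact: measurable_indic.
- by exists 1 => x; rewrite indicE normr_nat lern1 leq_b1.
- rewrite (_ : (fun Q : prob => _) = fun Q : prob => fine (Q A)).
    rewrite (_ : \int[P]_x _ = fine (P A)); first exact: clopen_cvg.
    by rewrite /Rintegral integral_indic// setIT.
  by apply/funext => Q; rewrite /Rintegral integral_indic// setIT.
Qed.

Lemma integral_cvgD F G : integral_cvg F -> integral_cvg G ->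
  integral_cvg (fun x => F x + G x).
Proof.
move=> [mF bF cF] [mG bG cG]; split.
- exact: measurable_funD.
- have [[M FM] [N GN]] := (bF, bG); exists (M + N) => x.
  by apply: le_trans (ler_normD _ _) _; apply: lerD.
- rewrite RintegralD//; [|exact: integrable_prob..].
  rewrite (_ : (fun Q : prob => _) =
    fun Q : prob => \int[Q]_x F x + \int[Q]_x G x); first exact: cvgD.
  by apply/funext => Q; rewrite RintegralD//; exact: integrable_prob.
Qed.

Lemma integral_cvgZ c F : integral_cvg F -> integral_cvg (fun x => c * F x).
Proof.
move=> [mF bF cF]; split.
- exact: measurable_funM.
- have [M FM] := bF; exists (`|c| * M) => x.
  by rewrite normrM ler_wpM2l.
- rewrite RintegralZl//; last exact: integrable_prob.
  rewrite (_ : (fun Q : prob => _) = fun Q : prob => c * \int[Q]_x F x).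
    by apply: cvgM => //; exact: cvg_cst.
  by apply/funext => Q; rewrite RintegralZl//; exact: integrable_prob.
Qed.

Lemma integral_cvg_sum {J : Type} (s : seq J) F :
  (forall j, integral_cvg (F j)) -> integral_cvg (fun x => \sum_(j <- s) F j x).
Proof.
move=> cF; elim: s => [|j s IH].
  under eq_fun => x do rewrite big_nil -(mul0r (\1_(set0 : set T) x)).
  by apply: integral_cvgZ; apply: integral_cvg_indic; exact: clopen0.
by under eq_fun do rewrite big_cons; exact: integral_cvgD.
Qed.

Lemma integral_cvg_locally_constant (F : T -> R) :
  locally_constant F -> integral_cvg F.
Proof.
move=> lF; have [s us Fs] := locally_constant_finite_range F compactT lF.
(* [F] is a simple function over its clopen fibres; since [s] has no duplicates, only the term
   [v = F x] survives at [x]. *)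
rewrite (_ : F = fun x => \sum_(v <- s) v * \1_(F @^-1` [set v]) x).
  apply: integral_cvg_sum => v; apply: integral_cvgZ; apply: integral_cvg_indic.
  exact: locally_constant_clopen.
apply/funext => x; rewrite (bigD1_seq (F x))//= indicE mem_set// mulr1.
rewrite big1 ?addr0// => v vFx; rewrite indicE memNset ?mulr0//=.
by move=> /esym/eqP; rewrite (negPf vFx).
Qed.

(** A three-epsilon argument: replacing [F] by [G] moves the integral by at most [e / 3] under every
    probability, hence uniformly along [U] and also at [P]. *)
Lemma integral_cvg_approx (F : T -> R) : locally_constant_approx F ->
  (fun Q : prob => \int[Q]_(x in [set: borel]) F x) @ U -->
    \int[P]_(x in [set: borel]) F x.
Proof.
move=> aF; apply/cvgrPdist_le => e e0.
have e3 : 0 < e / 3 by rewrite divr_gt0.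
have [G lG FG] := aF _ e3.
have iF := locally_constant_approx_integrable _ F aF.
have [mG bG cG] := integral_cvg_locally_constant G lG.
have dist (Q : prob) :
    `|\int[Q]_(x in [set: borel]) F x - \int[Q]_(x in [set: borel]) G x| <= e / 3.
  have mFG := measurable_funB (locally_constant_approx_measurable F aF) mG.
  rewrite -RintegralB//; [|exact: iF|exact: (integrable_prob Q G mG bG)].
  have iFG : Q.-integrable setT (EFin \o (fun x : borel => F x - G x)).
    by apply: integrable_prob; [exact: mFG | exists (e / 3)].
  apply: le_trans (le_normr_Rintegral _ iFG) _ => //.
  have <- : \int[Q]_(_ in [set: borel]) (e / 3) = e / 3.
    by rewrite Rintegral_cst// (congr1 fine (probability_setT Q)) mulr1.
  apply: le_Rintegral => //.
  - apply: integrable_prob; first by apply: measurableT_comp => //; exact: mFG.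
    by exists (e / 3) => x; rewrite normr_id.
  - by apply: integrable_prob; [exact: measurable_cst|exists `|e / 3|].
move/cvgrPdist_le : cG => /(_ _ e3); apply: filterS => Q PQ.
rewrite (_ : \int[P]_x F x - \int[Q]_x F x =
  (\int[P]_x F x - \int[P]_x G x) + (\int[P]_x G x - \int[Q]_x G x) +
  (\int[Q]_x G x - \int[Q]_x F x)); last by rewrite subrKA subrKA.
apply: le_trans (ler_normD _ _) _; rewrite (_ : e = e / 3 + e / 3 + e / 3).
  apply: lerD; last by rewrite distrC; exact: dist.
  by apply: le_trans (ler_normD _ _) _; apply: lerD => //; exact: dist.
by rewrite -mulr2n -mulrSr -[_ *+ 3]mulr_natr divfK.
Qed.

End UltraLimit.

Hypothesis open_bigcup_clopen : forall O : set T, open O ->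
  exists2 F : nat -> set T, (forall n, clopen (F n)) & O = \bigcup_n F n.

Lemma exists_maximizing_probability {J : countType} {K : Type}
    (D : J -> set T) (C : K -> T -> R) (W : T -> R) :
  (forall j, clopen (D j)) -> (forall k, locally_constant_approx (C k)) ->
  locally_constant_approx W ->
  let feasible (P : prob) := P (\bigcap_j D j) = 1%E /\
    forall k, (0 <= \int[P]_(x in [set: borel]) (C k x)%:E)%E in
  (exists P, feasible P) ->
  exists P, feasible P /\ forall Q, feasible Q ->
    (\int[Q]_(x in [set: borel]) (W x)%:E <=
     \int[P]_(x in [set: borel]) (W x)%:E)%E.
Proof.
move=> cD aC aW feasible [P0 fP0].
pose obj (Q : prob) := \int[Q]_(x in [set: borel]) W x.
(* Objective values are totally ordered, so these sets are nested and generate a filter; each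
   contains its own [Q], so the filter is proper. *)
pose better : set_system prob := filter_from feasible
  (fun Q => [set P | feasible P /\ obj Q <= obj P]).
have pfb : ProperFilter better.
  apply: filter_from_proper; last by move=> Q fQ; exists Q; split.
  apply: filter_from_filter; first by exists P0.
  move=> Q Q' fQ fQ'; have [QQ'|Q'Q] := leP (obj Q) (obj Q').
    by exists Q' => // P [fP Q'P]; split; split=> //; exact: le_trans QQ' Q'P.
  by exists Q => // P [fP QP]; split; split=> //; exact: le_trans (ltW Q'Q) QP.
have [U [UU bU]] := ultraFilterLemma pfb.
have [P PU] := ultra_clopen_limit compactT open_bigcup_clopen U UU.
have Ufeas : \forall Q \near U, feasible Q by apply: bU; exists P0 => // Q [].
have cI := @integral_cvg_approx U UU P PU.
have mD j : measurable (D j : set borel) by exact: clopen_measurable.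
(* Countability of [J] turns the intersection into the complement of a sequence of sets; codes of no
   index contribute [set0]. *)
have bigcapD : \bigcap_j D j = ~` \bigcup_n
    (if unpickle n is Some j then ~` D j else set0).
  apply/seteqP; split=> [x Dx [n _]|x nDx j _].
    by case: unpickle => // j; apply; exact: Dx.
  by apply: contrapT => nDj; apply: nDx; exists (pickle j); rewrite ?pickleK.
have mcap : measurable (\bigcap_j D j : set borel).
  rewrite bigcapD; apply: measurableC; apply: bigcupT_measurable => n.
  by case: unpickle => // j; exact: measurableC.
exists P; split; [split|].
(* Along [U] every [Q] is feasible and gives the smaller set [\bigcap_j D j] mass 1, so the mass of
   [D j] is constantly 1 there. *)
- have PD j : P (D j) = 1%E.
    rewrite -[LHS]fineK ?fin_num_measure//; congr EFin.
    have cv := PU _ (cD j); apply/esym; move: cv; apply: (@cvg_unique R^o) => //.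
    apply: cvg_near_cst; near=> Q.
    have [QD _] : feasible Q by near: Q.
    suff -> : Q (D j) = 1%E by [].
    apply/eqP; rewrite eq_le probability_le1//= -QD le_measure ?inE//.
    by move=> x; apply.
  (* The complements of the [D j] are [P]-null, hence so is their countable union [B]. *)
  rewrite bigcapD; set B := \bigcup_n _.
  have mB : measurable (B : set borel).
    by rewrite -[B]setCK; apply: measurableC; rewrite -bigcapD.
  rewrite probability_setC// [P B](measure_negligible mB) ?sube0//.
  apply: negligible_bigcup => n; case: unpickle => [j|]; last exact: negligible_set0.
  apply/negligibleP; first exact: measurableC.
  by apply: etrans (probability_setC P (mD j)) _; rewrite PD subee.
- move=> k; rewrite integral_approxE// lee_fin.
  apply: (cvgr_to_ge (cI _ (aC k))); near=> Q.
  have [_ /(_ k)] : feasible Q by near: Q.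
  by rewrite integral_approxE.
- move=> Q fQ; rewrite !integral_approxE// lee_fin.
  apply: (cvgr_to_ge (cI _ aW)).
  by apply: bU; exists Q => // P' [].
Unshelve. all: by end_near. Qed.

End ClopenWeakLimit.

(** * Topology of the space of plans *)

Section PlanSpace.
Context {S A : finType} {a0 : A}.
Local Notation plans := (plan_top S a0).

Lemma plan_top_compact : compact [set: plans].
Proof.
have cA : compact [set: discrete_topology (Apt a0)].
  by apply: finite_compact; exact: (@finite_finset A setT).
have := @tychonoff (hist S) (fun=> discrete_topology (Apt a0)) (fun=> setT)
  (fun=> cA).
by rewrite (_ : [set _ | _] = setT)//; apply/seteqP; split.
Qed.

Lemma plan_eval_locally_constant (h : hist S) :
  locally_constant (fun a : plans => a h : A).
Proof.
move=> a.
have := @proj_continuous (hist S) (fun=> discrete_topology (Apt a0)) h a.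
by move=> /(_ [set a h] (discrete_set1 _)).
Qed.

(** The product topology is the supremum of those induced by the coordinates, so convergence of the
    filter [G] to [a] is checked one history at a time. *)
Lemma plan_nbhs_agree (a : plans) (W : set plans) : nbhs a W ->
  exists s : seq (hist S), [set b : plans | {in s, b =1 a}] `<=` W.
Proof.
pose G : set_system plans :=
  filter_from setT (fun s : seq (hist S) => [set b : plans | {in s, b =1 a}]).
have FG : Filter G.
  apply: filter_from_filter; first by exists [::].
  move=> s s' _ _; exists (s ++ s') => // b /= ba.
  by split=> h hs; apply: ba; rewrite mem_cat hs ?orbT.
suff : G --> a by move=> /[apply] -[s _ sW]; exists s.
apply/cvg_sup => h V [_ [[D oD <-] Dah DV]].
by exists [:: h] => // b ba; apply: DV => /=; rewrite ba ?mem_head.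
Qed.

(** Cylinders are coded by finite lists of history-action pairs, of which there are countably many;
    [O] is the union of the cylinders inside it. *)
Lemma plan_open_bigcup_clopen (O : set plans) : open O ->
  exists2 F : nat -> set plans, (forall n, clopen (F n)) & O = \bigcup_n F n.
Proof.
move=> oO.
pose cyl (s : seq (hist S * A)) : set plans :=
  [set a : plans | all (fun hb => (a hb.1 : A) == hb.2) s].
have cyl_clopen s : clopen (cyl s).
  apply: (locally_constant_clopen
    (fun a : plans => all (fun hb => (a hb.1 : A) == hb.2) s) [set true]).
  elim: s => [|hb s IH] /=; first exact: locally_constant_cst.
  apply: (locally_constant_comp2 andb) => //.
  by apply: (locally_constant_comp (eq_op^~ hb.2)); exact: plan_eval_locally_constant.
exists (fun n => if unpickle n is Some s then
    if `[< cyl s `<=` O >] then cyl s else set0 else set0).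
  move=> n; case: unpickle => [s|]; last exact: clopen0.
  by case: ifP => // _; exact: clopen0.
apply/seteqP; split=> [a Oa|a [n _]]; last first.
  by case: unpickle => // s; case: asboolP => // sO /sO.
have [s sO] := plan_nbhs_agree a O (open_nbhs_nbhs (conj oO Oa)).
pose s' := [seq (h, a h : A) | h <- s].
exists (pickle s') => //; rewrite pickleK asboolT.
  by apply/allP => _ /mapP[h _ ->] /=.
move=> b /allP sb; apply: sO => h hs; apply/eqP.
by apply: (sb (h, a h : A)); apply/mapP; exists h.
Qed.

(* Not a canonical instance on [plan_top]: that would change how the types
   [probability (plan_borel S a0) R] of the theorem are elaborated. *)
Definition plan_ptop : ptopologicalType :=
  HB.pack plans (Pointed.on (hist S -> discrete_topology (Apt a0)))
    (Topological.on plans).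

(** * States and discounted payoffs as functions of the plan *)

Section payoffs.
Context {R : realType} {X : Type}.
Variables (pi : S -> S -> R) (beta : R) (zeta : X -> A -> S -> X) (x0 : X).

(** A run reads finitely many coordinates of the plan. The initial state may vary with the plan
    because, after one step of the induction, it depends on the action taken. *)
Lemma xrun_locally_constant (s0 : S) (x : plans -> X) (pre rest : seq S) :
  locally_constant x ->
  locally_constant (fun a : plans => xrun zeta a s0 (x a) pre rest).
Proof.
elim: rest x pre => [|s' rest IH] x pre lx //=.
apply: (IH (fun a : plans => zeta (x a) (a (s0, pre)) (last s0 pre))).
apply: (locally_constant_comp2 (fun y b => zeta y b (last s0 pre))) => //.
exact: plan_eval_locally_constant.
Qed.

Lemma stage_locally_constant {V : Type} (f : X -> A -> S -> V) (h : hist S) :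
  locally_constant (fun a : plans => f (xof zeta x0 a h) (a h) (hcur h)).
Proof.
apply: (locally_constant_comp2 (fun y b => f y b (hcur h))).
  by apply: xrun_locally_constant; exact: locally_constant_cst.
exact: plan_eval_locally_constant.
Qed.

Lemma past_actions_match_locally_constant (s0 : S) (t : nat)
    (st : t.-tuple S) (ta : t.-tuple A) :
  locally_constant (fun a : plans => past_actions_match a s0 st ta).
Proof.
have lM : locally_constant (fun a : plans =>
    [ffun k : 'I_t => (a (s0, take k st) : A) == tnth ta k]).
  apply: locally_constant_finfun => k.
  by apply: (locally_constant_comp (eq_op^~ _)); exact: plan_eval_locally_constant.
rewrite (_ : (fun _ => _) = fun a : plans => [forall k : 'I_t,
    [ffun k : 'I_t => (a (s0, take k st) : A) == tnth ta k] k]).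
  exact: (locally_constant_comp (fun u : {ffun 'I_t -> bool} => [forall k, u k])).
by apply/funext => a; apply: eq_forallb => k; rewrite ffunE.
Qed.

Definition disc_sum (f : X -> A -> S -> R) (h : hist S) (a : plan S A)
    (N : nat) : R :=
  \sum_(0 <= n < N) beta ^+ n * cond_exp pi h n (stage f zeta x0 a).

Lemma disc_sum_locally_constant (f : X -> A -> S -> R) (h : hist S) (N : nat) :
  locally_constant (fun a : plans => disc_sum f h a N).
Proof.
apply: locally_constant_sum => n; apply: locally_constant_comp.
apply: locally_constant_sum => l; apply: locally_constant_comp.
exact: stage_locally_constant.
Qed.

Hypothesis pi_ge0 : forall s s', 0 <= pi s s'.
Hypothesis pi_sum1 : forall s, \sum_s' pi s s' = 1.
Hypothesis beta01 : 0 < beta < 1.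

Lemma ppath_ge0 (s : S) (l : seq S) : 0 <= ppath pi s l.
Proof. by elim: l s => [|s' l IH] s //=; rewrite mulr_ge0. Qed.

Lemma sum_ppath (s : S) (n : nat) : \sum_(l : n.-tuple S) ppath pi s l = 1.
Proof.
elim: n s => [|n IH] s.
  rewrite (bigD1 [tuple])//= big1 ?addr0// => l.
  by rewrite (tuple0 l) => /negP[].
rewrite (reindex (fun u : S * n.-tuple S => [tuple of u.1 :: u.2])) /=; last first.
  (* A path of length [n.+1] is split into its first shock and the remaining path. *)
  exists (fun l : n.+1.-tuple S => (thead l, [tuple of behead l])).
    by move=> [s' l] _ /=; congr pair; apply/val_inj.
  by move=> l _; rewrite [RHS]tuple_eta.
rewrite -(pair_bigA _ (fun s' (l : n.-tuple S) => pi s s' * ppath pi s' l))/=.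
by rewrite -[RHS](pi_sum1 s); apply: eq_bigr => s' _; rewrite -mulr_sumr IH mulr1.
Qed.

Lemma cond_exp_bound (M : R) (h : hist S) (n : nat) (F : hist S -> R) :
  (forall h, `|F h| <= M) -> `|cond_exp pi h n F| <= M.
Proof.
move=> FM; apply: le_trans (ler_norm_sum _ _ _) _.
rewrite -[leRHS]mul1r -(sum_ppath (hcur h) n) mulr_suml; apply: ler_sum => l _.
by rewrite normrM ger0_norm ?ppath_ge0// ler_wpM2l ?ppath_ge0.
Qed.

(** The horizon [N] is read off the geometric series with terms [M * beta ^+ n], which dominates the
    discounted series of every plan; this makes the error uniform in [a]. *)
Lemma disc_val_approx (f : X -> A -> S -> R) (h : hist S) (e : R) :
  bounded_payoff f -> 0 < e ->
  exists N, forall a : plan S A,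
    `|disc_val pi beta zeta f x0 a h - disc_sum f h a N| <= e.
Proof.
move=> [M fM] e0; have /andP[/ltW b0 b1] := beta01.
have nb1 : `|beta| < 1 by rewrite ger0_norm.
pose v := geometric M beta.
have cv : cvgn (series v) by exact: is_cvg_geometric_series.
have [N _ vN] : \forall N \near \oo, `|limn (series v) - series v N| <= e.
  by move/cvgrPdist_le : cv => /(_ _ e0).
exists N => a.
pose u n := beta ^+ n * cond_exp pi h n (stage f zeta x0 a).
have uv n : `|u n| <= v n.
  rewrite normrM ger0_norm ?exprn_ge0// mulrC -[v n]/(M * beta ^+ n).
  rewrite ler_wpM2r ?exprn_ge0//; apply: cond_exp_bound => h'; exact: fM.
(* The sign of [M] is only known through the norms that it bounds. *)
have v0 n : 0 <= v n by apply: le_trans (uv n).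
have cu : cvgn (series u).
  apply: normed_cvg; apply: series_le_cvg cv => // n; exact: normr_ge0.
rewrite (_ : disc_val _ _ _ _ _ _ _ = limn (series u))//.
rewrite (_ : disc_sum _ _ _ _ = series u N)//.
have tail K : (N <= K)%N -> `|series u K - series u N| <= limn (series v) - series v N.
  move=> NK; rewrite sub_series_geq//.
  apply: le_trans (ler_norm_sum _ _ _) _.
  apply: (@le_trans _ _ (\sum_(N <= k < K) v k)); first exact: ler_sum.
  rewrite -sub_series_geq// lerD2r; apply: nondecreasing_cvgn_le => //.
  exact: nondecreasing_series.
(* It remains to let [K] tend to infinity in [tail]. *)
apply: le_trans (le_trans (ler_norm _) (vN N (leqnn N))).
have cuN : cvgn (fun K => `|series u K - series u N|).
  by apply: is_cvg_norm; apply: is_cvgB => //; exact: is_cvg_cst.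
rewrite (_ : `|_| = limn (fun K => `|series u K - series u N|)).
  by apply: limr_le => //; near=> K; apply: tail; near: K; exact: nbhs_infty_ge.
apply/esym/cvg_lim => //; apply: cvg_norm; apply: cvgB => //; exact: cvg_cst.
Unshelve. all: by end_near. Qed.

End payoffs.
End PlanSpace.

(** * Existence of an optimal lottery over plans *)

Theorem theorem4p3 (R : realType) (S A : finType) (a0 : A) (X : countType)
  (I : nat) (pi : S -> S -> R) (zeta : X -> A -> S -> X)
  (p r : X -> A -> S -> R) (g : 'I_I -> X -> A -> S -> R) (gbar : 'I_I -> R)
  (beta : R) :
  (forall s s' : S, 0 < pi s s') ->
  (forall s : S, \sum_(s' : S) pi s s' = 1) ->
  0 < beta < 1 ->
  bounded_payoff r ->
  (forall i : 'I_I, bounded_payoff (g i)) ->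
  (forall (x0 : X) (s0 : S), exists a : plan S A,
      feasible_plan pi beta zeta p g gbar x0 a) ->
  forall (gam : 'I_I -> R) (x0 : X) (s0 : S),
  exists Pstar : probability (plan_borel S a0) R,
    lottery_feasible pi beta zeta p g gbar x0 Pstar /\
    forall P : probability (plan_borel S a0) R,
      lottery_feasible pi beta zeta p g gbar x0 P ->
      (lottery_obj pi beta zeta r g gam x0 s0 P
         <= lottery_obj pi beta zeta r g gam x0 s0 Pstar)%E.
Proof.
move=> pi0 pi1 b01 [Mr rM] gM ex gam x0 s0.
pose T : ptopologicalType := @plan_ptop S A a0.
pose D (h : hist S) : set T :=
  [set a | 0 <= p (xof zeta x0 a h) (a h) (hcur h)].
(* One index type gathers the constraints of all dates, histories and goods [i], to match the family
   [C] of the abstract existence lemma. *)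
pose K := {t : nat & (S * t.-tuple S * t.-tuple A * 'I_I)%type}.
pose C (k : K) (a : T) : R :=
  let: existT t (s, st, ta, i) := k in
  (past_actions_match a s st ta)%:R *
  (disc_val pi beta zeta (g i) x0 a (s, val st) - gbar i).
pose f x b s : R := r x b s + \sum_(i < I) gam i * g i x b s.
pose W (a : T) := disc_val pi beta zeta f x0 a (s0, [::]).
have pi_ge0 s s' : 0 <= pi s s' by exact: ltW.
have cD h : clopen (D h).
  apply: (locally_constant_clopen
    (fun a : plan_top S a0 => p (xof zeta x0 a h) (a h) (hcur h))
    [set y | 0 <= y]).
  exact: stage_locally_constant.
have aC k : locally_constant_approx (C k).
  case: k => t [[[s st] ta] i] e e0.
  have [N N_e] := disc_val_approx pi beta zeta x0 pi_ge0 pi1 b01 (g i) (s, val st) e (gM i) e0.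
  exists (fun a => (past_actions_match a s st ta)%:R *
    (disc_sum pi beta zeta x0 (g i) (s, val st) a N - gbar i)).
    apply: (locally_constant_comp2 (fun (b : bool) y => b%:R * (y - gbar i))).
      exact: past_actions_match_locally_constant.
    exact: disc_sum_locally_constant.
  (* [gbar i] cancels and the indicator is at most 1, leaving only the truncation error. *)
  move=> a; rewrite -mulrBr opprB subrKA.
  apply: le_trans (N_e a); rewrite normrM normr_nat.
  by rewrite ler_piMl// lern1 leq_b1.
have fM : bounded_payoff f.
  have /choice[M gMM] := gM; exists (Mr + \sum_(i < I) `|gam i| * M i) => x b s.
  apply: le_trans (ler_normD _ _) _; apply: lerD => //.
  apply: le_trans (ler_norm_sum _ _ _) _; apply: ler_sum => i _.
  by rewrite normrM ler_wpM2l.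
have aW : locally_constant_approx W.
  move=> e e0.
  have [N N_e] := disc_val_approx pi beta zeta x0 pi_ge0 pi1 b01 f (s0, [::]) e fM e0.
  by exists (fun a => disc_sum pi beta zeta x0 f (s0, [::]) a N) => //;
    exact: disc_sum_locally_constant.
have feasE (P : probability (plan_borel S a0) R) :
    lottery_feasible pi beta zeta p g gbar x0 P <->
    P (\bigcap_h D h) = 1%E /\
    forall k, (0 <= \int[P]_(a in [set: plan_borel S a0]) (C k a)%:E)%E.
  have -> : \bigcap_h D h = [set a | admissible p zeta x0 a].
    by apply/seteqP; split=> a Da h; [exact: Da|move=> _; exact: Da].
  split=> -[PD PC]; split=> //.
    by move=> [t [[[s st] ta] i]]; exact: PC.
  by move=> t s st ta i; exact: (PC (existT _ t (s, st, ta, i))).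
have [|P [fP maxP]] := @exists_maximizing_probability R T
  (@plan_top_compact S A a0) (@plan_open_bigcup_clopen S A a0) _ _ D C W cD aC aW.
(* The Dirac mass at a feasible plan is a feasible lottery: each integral becomes an indicator times
   a nonnegative surplus. *)
- have [a [adma fa]] := ex x0 s0.
  exists (\d_(a : plan_borel S a0)); split.
    rewrite /= diracE mem_set// => h _; exact: adma.
  move=> k; rewrite integral_dirac//; last first.
    apply/measurable_EFinP.
    exact: (locally_constant_approx_measurable (C k) (aC k)).
  rewrite diracT mul1e lee_fin; case: k => t [[[s st] ta] i] /=.
  by rewrite mulr_ge0// subr_ge0.
- exists P; split; first exact/feasE.
  by move=> Q /feasE; exact: maxP.
Qed.
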